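(* Let $F_2$ be the free group on $x,y$, let $B=[x,y]$, and let $G=\langle x,y\mid \Gamma_4,[B,y]\rangle$ be the quotient of $F_2/\Gamma_4(F_2)$ by the normal closure of the image of $[B,y]$. For every integer $n\ge 0$, the group $G\times\mathbb Z^n$ is a finitely generated torsion-free nilpotent group of Hirsch length $n+4$ which has the $R_\infty$ property. In particular, for every integer $\ell\ge 4$ there is a finitely generated torsion-free nilpotent group of Hirsch length $\ell$ with the $R_\infty$ property.
   Context: $\Gamma_i(F_2)$ is the $i$-th term of the lower central series, with $\Gamma_1(F_2)=F_2$ and $\Gamma_{i+1}(F_2)=[\Gamma_i(F_2),F_2]$; $[a,b]=aba^{-1}b^{-1}$. The Hirsch length of a finitely generated nilpotent group is the number of infinite cyclic factors in a subnormal series with cyclic factors. For an endomorphism $\varphi:H\to H$ of a group, $H$ acts on itself by $\sigma\cdot\alpha=\sigma\alpha\varphi(\sigma)^{-1}$. The Reidemeister number $R(\varphi)$ is the number of orbits ($\infty$ if there are infinitely many). A group $H$ has the $R_\infty$ property if $R(\varphi)=\infty$ for every automorphism $\varphi$ of $H$. *)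

(* Defs.v *)
From HB Require Import structures.
From mathcomp Require Import all_boot all_algebra.
From mathcomp Require Import boolp classical_sets functions cardinality.

Set Implicit Arguments.
Unset Strict Implicit.
Unset Printing Implicit Defensive.

Local Open Scope classical_set_scope.
Local Open Scope group_scope.
Local Open Scope quotient_scope.

Section Subgroups.
Variable G : groupType.
Implicit Types (a b g : G) (A B H K S : set G).

Definition is_subgroup H :=
  [/\ H 1, (forall a b, H a -> H b -> H (a * b)) & (forall a, H a -> H a^-1)].

Definition normal_in K H :=
  [/\ is_subgroup K, is_subgroup H, K `<=` H
    & forall g a, H g -> K a -> K (g * a * g^-1)].

Definition is_normal K := normal_in K setT.

Definition generated S : set G := smallest is_subgroup S.

Definition normal_closure S : set G := smallest is_normal S.

(* The library's [~ a, b] is a^-1 * b^-1 * a * b. *)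
Definition comm a b := a * b * a^-1 * b^-1.

Definition comm_subgroup A B : set G :=
  generated [set c | exists a b, [/\ A a, B b & c = comm a b]].

(* The lower central series, indexed from 1; the value at 0 is a dummy. *)
Fixpoint Gamma (i : nat) : set G :=
  match i with
  | 0 => setT
  | j.+1 => if j is 0 then setT else comm_subgroup (Gamma j) setT
  end.

Lemma subgroup_setT : is_subgroup setT. Proof. by split. Qed.

Lemma generated_subgroup S : is_subgroup (generated S).
Proof.
split=> [H [[]] //|a b Sa Sb H HS|a Sa H HS].
- by have [[_ HM _] _] := HS; apply: HM; [exact: Sa|exact: Sb].
- by have [[_ _ HV] _] := HS; apply: HV; exact: Sa.
Qed.

Lemma normal_closure_normal S : is_normal (normal_closure S).
Proof.
split=> //; last by move=> g a _ Sa H HS;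
  have [[_ _ _ HJ] _] := HS; apply: HJ => //; exact: Sa.
split=> [H [[[]]] //|a b Sa Sb H HS|a Sa H HS].
- by have [[[_ HM _] _ _ _] _] := HS; apply: HM; [exact: Sa|exact: Sb].
- by have [[[_ _ HV] _ _ _] _] := HS; apply: HV; exact: Sa.
Qed.

Lemma comm_subgroup_normal A : is_normal A -> is_normal (comm_subgroup A setT).
Proof.
move=> [_ _ _ nA]; have sgC := generated_subgroup
  [set c | exists a b, [/\ A a, setT b & c = comm a b]].
have [C1 CM CV] := sgC.
split=> // g x _ Cx; move: x Cx.
suff sub : comm_subgroup A setT `<=`
    [set x | comm_subgroup A setT (g * x * g^-1)] by exact: sub.
apply: smallest_sub; first split=> /= [|x y Cx Cy|x Cx].
- by rewrite mulg1 mulgV.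
- have -> : g * (x * y) * g^-1 = (g * x * g^-1) * (g * y * g^-1).
    by rewrite !mulgA mulgVK.
  exact: CM.
- have -> : g * x^-1 * g^-1 = (g * x * g^-1)^-1 by rewrite !invgM invgK mulgA.
  exact: CV.
move=> _ [a [b [Aa _ ->]]] H [sgH HS] /=; apply: HS.
exists (g * a * g^-1), (g * b * g^-1); split=> //; first exact: nA.
by rewrite /comm !invgM !invgK !mulgA !mulgVK.
Qed.

Lemma Gamma_normal i : is_normal (Gamma i).
Proof.
have nT : is_normal setT by split.
by elim: i => [|[|i] IH] //=; exact: comm_subgroup_normal.
Qed.

End Subgroups.

Arguments Gamma G i : clear implicits.
Arguments Gamma_normal G i : clear implicits.

Structure normalSubgroup (G : groupType) := NormalSubgroup {
  normal_set : set G;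
  normal_setP : is_normal normal_set
}.

Section Quotient.
Variables (G : groupType) (N : normalSubgroup G).

Definition coset_rel (a b : G) := `[< normal_set N (a^-1 * b) >].

Lemma coset_rel_refl : reflexive coset_rel.
Proof.
by move=> a; apply/asboolP; rewrite mulVg; have [[]] := normal_setP N.
Qed.

Lemma coset_rel_sym : symmetric coset_rel.
Proof.
have [[_ _ NV] _ _ _] := normal_setP N.
have sym a b : coset_rel a b -> coset_rel b a.
  by move=> /asboolP /NV; rewrite invgM invgK => ?; apply/asboolP.
by move=> a b; apply/idP/idP; exact: sym.
Qed.

Lemma coset_rel_trans : transitive coset_rel.
Proof.
have [[_ NM _] _ _ _] := normal_setP N.
move=> b a c /asboolP Nab /asboolP Nbc; apply/asboolP.
by have := NM _ _ Nab Nbc; rewrite mulgA mulgK.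
Qed.

Canonical coset_equiv :=
  EquivRel coset_rel coset_rel_refl coset_rel_sym coset_rel_trans.

Definition quotient_group := {eq_quot coset_equiv}.

HB.instance Definition _ := Choice.on quotient_group.
HB.instance Definition _ := EqQuotient.on quotient_group.

Definition quotient_pi (a : G) : quotient_group := \pi_quotient_group a.

Definition quotient_one : quotient_group := quotient_pi 1.
Definition quotient_mul (u v : quotient_group) := quotient_pi (repr u * repr v).
Definition quotient_inv (u : quotient_group) := quotient_pi (repr u)^-1.

Lemma quotient_piP (a b : G) :
  quotient_pi a = quotient_pi b <-> normal_set N (a^-1 * b).
Proof. by split=> [/eqmodP/asboolP //|?]; apply/eqmodP/asboolP. Qed.

Lemma quotient_piK : cancel (repr : quotient_group -> G) quotient_pi.
Proof. exact: reprK. Qed.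

Lemma quotient_piM (a b : G) :
  quotient_pi (a * b) = quotient_mul (quotient_pi a) (quotient_pi b).
Proof.
have [[_ NM _] _ _ NJ] := normal_setP N.
have Nr c : normal_set N (c^-1 * repr (quotient_pi c)).
  by apply/quotient_piP; rewrite quotient_piK.
apply/quotient_piP; move: (Nr a) (Nr b).
set a' := repr _; set b' := repr _ => Na Nb.
have := NM _ _ (NJ b^-1 _ I Na) Nb.
by rewrite invgK invgM !mulgA mulgK.
Qed.

Lemma quotient_piV (a : G) :
  quotient_pi a^-1 = quotient_inv (quotient_pi a).
Proof.
have [[_ _ NV] _ _ NJ] := normal_setP N.
apply/quotient_piP; rewrite invgK.
have : normal_set N (a^-1 * repr (quotient_pi a)).
  by apply/quotient_piP; rewrite quotient_piK.
by move/(NJ a _ I)/NV; rewrite mulgA mulgV mul1g invgM invgK.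
Qed.

Lemma quotient_mulA : associative quotient_mul.
Proof.
move=> u v w; rewrite -[u]quotient_piK -[v]quotient_piK -[w]quotient_piK.
by rewrite -!quotient_piM mulgA.
Qed.

Lemma quotient_mul1 : left_id quotient_one quotient_mul.
Proof. by move=> u; rewrite -[u]quotient_piK -quotient_piM mul1g. Qed.

Lemma quotient_1mul : right_id quotient_one quotient_mul.
Proof. by move=> u; rewrite -[u]quotient_piK -quotient_piM mulg1. Qed.

Lemma quotient_mulV : left_inverse quotient_one quotient_inv quotient_mul.
Proof.
by move=> u; rewrite -[u]quotient_piK -quotient_piV -quotient_piM mulVg.
Qed.

Lemma quotient_Vmul : right_inverse quotient_one quotient_inv quotient_mul.
Proof.
by move=> u; rewrite -[u]quotient_piK -quotient_piV -quotient_piM mulgV.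
Qed.

HB.instance Definition _ := isGroup.Build quotient_group
  quotient_mulA quotient_mul1 quotient_1mul quotient_mulV quotient_Vmul.

HB.instance Definition _ :=
  isMultiplicative.Build G quotient_group quotient_pi quotient_piM.

End Quotient.

(* The free group on X: words in the letters (a, false) = a and
   (a, true) = a^-1, modulo insertion and deletion of a a^-1 and a^-1 a. *)
Section FreeGroup.
Variable X : choiceType.

Definition word := seq (X * bool).

Inductive free_equiv : word -> word -> Prop :=
| free_cancel u v a e : free_equiv (u ++ (a, e) :: (a, ~~ e) :: v) (u ++ v)
| free_refl u : free_equiv u u
| free_sym u v : free_equiv u v -> free_equiv v u
| free_trans u v w : free_equiv u v -> free_equiv v w -> free_equiv u w.

Definition free_rel (u v : word) := `[< free_equiv u v >].

Lemma free_rel_refl : reflexive free_rel.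
Proof. by move=> u; apply/asboolP; exact: free_refl. Qed.

Lemma free_rel_sym : symmetric free_rel.
Proof.
by move=> u v; apply/idP/idP => /asboolP /free_sym ?; apply/asboolP.
Qed.

Lemma free_rel_trans : transitive free_rel.
Proof.
move=> v u w /asboolP uv /asboolP vw; apply/asboolP; exact: free_trans uv vw.
Qed.

Canonical free_rel_equiv :=
  EquivRel free_rel free_rel_refl free_rel_sym free_rel_trans.

Definition free_group := {eq_quot free_rel_equiv}.

HB.instance Definition _ := Choice.on free_group.
HB.instance Definition _ := EqQuotient.on free_group.

Definition word_inv (u : word) : word := rev [seq (l.1, ~~ l.2) | l <- u].

Definition free_pi (u : word) : free_group := \pi_free_group u.

Definition free_one : free_group := free_pi [::].
Definition free_mul (p q : free_group) := free_pi (repr p ++ repr q).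
Definition free_inv (p : free_group) := free_pi (word_inv (repr p)).
Definition free_gen (a : X) := free_pi [:: (a, false)].

Lemma free_piP (u v : word) : free_pi u = free_pi v <-> free_equiv u v.
Proof. by split=> [/eqmodP/asboolP //|?]; apply/eqmodP/asboolP. Qed.

Lemma free_piK : cancel (repr : free_group -> word) free_pi.
Proof. exact: reprK. Qed.

Lemma free_equiv_catl w u v : free_equiv u v -> free_equiv (w ++ u) (w ++ v).
Proof.
elim=> {u v} [u v a e|u|u v _ IH|u v z _ IH1 _ IH2].
- by rewrite !catA; exact: free_cancel.
- exact: free_refl.
- exact: free_sym.
- exact: free_trans IH1 IH2.
Qed.

Lemma free_equiv_catr w u v : free_equiv u v -> free_equiv (u ++ w) (v ++ w).
Proof.
elim=> {u v} [u v a e|u|u v _ IH|u v z _ IH1 _ IH2].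
- by rewrite -!catA; exact: free_cancel.
- exact: free_refl.
- exact: free_sym.
- exact: free_trans IH1 IH2.
Qed.

Lemma free_equiv_inv u v : free_equiv u v -> free_equiv (word_inv u) (word_inv v).
Proof.
elim=> {u v} [u v a e|u|u v _ IH|u v z _ IH1 _ IH2].
- rewrite /word_inv !map_cat /= !rev_cat !rev_cons -!cats1 -!catA /= negbK.
  exact: free_cancel.
- exact: free_refl.
- exact: free_sym.
- exact: free_trans IH1 IH2.
Qed.

Lemma free_piM (u v : word) :
  free_pi (u ++ v) = free_mul (free_pi u) (free_pi v).
Proof.
have Er w : free_equiv w (repr (free_pi w)) by apply/free_piP; rewrite free_piK.
apply/free_piP/(free_trans (free_equiv_catl u (Er v))).
exact: free_equiv_catr (Er u).
Qed.

Lemma free_piV (u : word) : free_pi (word_inv u) = free_inv (free_pi u).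
Proof. by apply/free_piP/free_equiv_inv/free_piP; rewrite free_piK. Qed.

Lemma word_invK : involutive word_inv.
Proof.
move=> u; rewrite /word_inv map_rev revK -map_comp.
by rewrite -[RHS]map_id; apply: eq_map => -[a e] /=; rewrite negbK.
Qed.

Lemma free_equivV (u : word) : free_equiv (u ++ word_inv u) [::].
Proof.
elim: u => [|[a e] u IH]; first exact: free_refl.
rewrite /word_inv /= rev_cons -cats1 catA.
exact: free_trans (free_equiv_catl [:: (a, e)] (free_equiv_catr _ IH))
  (free_cancel [::] [::] a e).
Qed.

Lemma free_mulA : associative free_mul.
Proof.
move=> p q r; rewrite -[p]free_piK -[q]free_piK -[r]free_piK.
by rewrite -!free_piM catA.
Qed.

Lemma free_mul1 : left_id free_one free_mul.
Proof. by move=> p; rewrite -[p]free_piK -free_piM. Qed.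

Lemma free_1mul : right_id free_one free_mul.
Proof. by move=> p; rewrite -[p]free_piK -free_piM cats0. Qed.

Lemma free_Vmul : right_inverse free_one free_inv free_mul.
Proof.
move=> p; rewrite -[p]free_piK -free_piV -free_piM.
by apply/free_piP; exact: free_equivV.
Qed.

Lemma free_mulV : left_inverse free_one free_inv free_mul.
Proof.
move=> p; rewrite -[p]free_piK -free_piV -free_piM -{2}[repr p]word_invK.
by apply/free_piP; exact: free_equivV.
Qed.

HB.instance Definition _ := isGroup.Build free_group
  free_mulA free_mul1 free_1mul free_mulV free_Vmul.

End FreeGroup.

Section Properties.
Variable G : groupType.
Implicit Types (g h s a : G) (H K : set G).

Definition finitely_generated := exists l : seq G, generated [set` l] = setT.

Definition torsion_free := forall g n, (0 < n)%N -> g ^+ n = 1 -> g = 1.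

Definition nilpotent := exists c, Gamma G c.+1 = [set 1].

Definition expgz g (k : int) : G :=
  match k with Posz n => g ^+ n | Negz n => g ^- n.+1 end.

Definition cosets H K : set (set G) :=
  [set [set h * k | k in K] | h in H].

(* The quotient H / K, for K normal in H, is cyclic: every coset hK equals
   g^k K for a fixed g. *)
Definition cyclic_factor H K :=
  exists2 g, H g & forall h, H h -> exists k : int, K ((expgz g k)^-1 * h).

Definition cyclic_series (H : nat -> set G) (m : nat) :=
  [/\ H 0 = [set 1], H m = setT
    & forall i, (i < m)%N ->
        normal_in (H i) (H i.+1) /\ cyclic_factor (H i.+1) (H i)].

Definition infinite_factors (H : nat -> set G) (m : nat) : nat :=
  #|[pred i : 'I_m | `[< infinite_set (cosets (H i.+1) (H i)) >]]|.

(* A relation rather than a function: that h does not depend on the chosen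
   series is the classical invariance of the Hirsch length. *)
Definition has_hirsch_length (h : nat) :=
  exists (H : nat -> set G) (m : nat),
    cyclic_series H m /\ infinite_factors H m = h.

Definition reidemeister_class (phi : G -> G) a : set G :=
  [set s * a * (phi s)^-1 | s in setT].

Definition reidemeister_classes (phi : G -> G) : set (set G) :=
  [set reidemeister_class phi a | a in setT].

Definition R_infinity := forall phi : {multiplicative G -> G},
  bijective phi -> infinite_set (reidemeister_classes phi).

End Properties.

Definition F2 : groupType := free_group bool.
Definition F2x : F2 := free_gen false.
Definition F2y : F2 := free_gen true.
Definition F2B : F2 := comm F2x F2y.

Definition Gamma4 : normalSubgroup F2 := NormalSubgroup (Gamma_normal F2 4).

Definition By_closure : normalSubgroup (quotient_group Gamma4) :=
  NormalSubgroup
    (normal_closure_normal [set quotient_pi Gamma4 (comm F2B F2y)]).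

Definition G_By : groupType := quotient_group By_closure.

(* Z^n, with its addition written multiplicatively. *)
Definition Zpow (n : nat) : groupType := Algebra.to_multiplicative 'rV[int]_n.

(* Main.v *)
Require Import Defs.
From HB Require Import structures.
From mathcomp Require Import all_boot all_algebra zify ring.
From mathcomp Require Import boolp classical_sets functions cardinality.

(** The group G is the split extension of Z^3 = <y, B, C> by the unipotent
    action of x, where C = [B, x], so every element is C^d B^c y^b x^a for unique
    integers. An automorphism phi of H = G x Z^n preserves the centralizer of the
    commutators, the second center and the center. The successive quotients of
    this chain from H down to its center are infinite cyclic, generated by x, y
    and B, and phi acts on them by signs e_x, e_y and e_x e_y. One of the three
    signs is 1, and the corresponding coordinate separates infinitely many
    Reidemeister classes: if e_x = 1 the x-coordinate; if e_x = -1 and e_y = 1 an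
    invariant functional of the abelianization; and otherwise the B-coordinate,
    because then phi has no nontrivial fixed point on the quotient <x, y> of H
    by its second center. *)

Set Implicit Arguments.
Unset Strict Implicit.
Unset Printing Implicit Defensive.

Import GRing.Theory Num.Theory.
Local Open Scope classical_set_scope.
Local Open Scope group_scope.

(** * Integer powers and group morphisms *)

Section IntegerPowers.
Variable G : groupType.
Implicit Types (g h : G) (k : int) (P : set G).

Lemma expgzS g k : expgz g (k + 1)%R = g * expgz g k.
Proof.
case: k => n; first by have -> : (Posz n + 1)%R = Posz n.+1 by [lia]; rewrite /= expgS.
case: n => [|n]; first by rewrite /= mulgV.
have -> : (Negz n.+1 + 1)%R = Negz n by lia.
by rewrite /= [in RHS]expgSr invgM mulVKg.
Qed.

(** Cancelling [g] runs the recursion backwards, so it also determines the negative powers. Later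
    power formulas are checked through these two equations. *)
Lemma expgz_unique (f : int -> G) g :
  f 0%R = 1 -> (forall k, f (k + 1)%R = g * f k) -> forall k, f k = expgz g k.
Proof.
move=> f0 fS; elim/int_ind => [|n IH|n IH]; first by rewrite f0.
  by have -> : Posz n.+1 = (Posz n + 1)%R by [lia]; rewrite fS IH expgzS.
apply: (mulgI g); rewrite -fS -expgzS.
by have -> : (- Posz n.+1 + 1 = - Posz n)%R by lia.
Qed.

Lemma expgzD g j k : expgz g (j + k)%R = expgz g j * expgz g k.
Proof.
suff -> : expgz g j = expgz g (j + k)%R * (expgz g k)^-1 by rewrite mulgVK.
rewrite -(@expgz_unique (fun i => expgz g (i + k)%R * (expgz g k)^-1) g) //.
  by rewrite add0r mulgV.
by move=> i; rewrite addrAC expgzS mulgA.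
Qed.

Lemma commute_expgz g h k : commute g h -> commute g (expgz h k).
Proof. by case: k => n gh; [|apply: commuteV]; exact: commuteX. Qed.

Lemma expgzMn g h k : commute g h -> expgz (g * h) k = expgz g k * expgz h k.
Proof.
move=> gh; rewrite -(@expgz_unique (fun k => expgz g k * expgz h k) (g * h)) //=.
  by rewrite mulg1.
move=> i; rewrite !expgzS -!mulgA; congr (g * _); rewrite !mulgA; congr (_ * _).
exact/commute_sym/commute_expgz/commute_sym.
Qed.

Lemma expVgz g k : expgz g^-1 k = expgz g (- k)%R.
Proof.
rewrite -(@expgz_unique (fun k => expgz g (- k)%R) g^-1) // => i.
by apply: (mulgI g); rewrite -expgzS mulVKg; congr expgz; ring.
Qed.

Lemma expgzJ g h k : g * expgz h k * g^-1 = expgz (g * h * g^-1) k.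
Proof.
apply: (@expgz_unique (fun k => g * expgz h k * g^-1)).
  by rewrite mulg1 mulgV.
by move=> i; rewrite expgzS !mulgA mulgVK.
Qed.

Lemma subgroup_expgz P g k : is_subgroup P -> P g -> P (expgz g k).
Proof.
move=> [P1 PM PV] Pg.
have Pn n : P (g ^+ n) by elim: n => [//|n IH]; rewrite expgS; exact: PM.
by case: k => n /=; [exact: Pn|apply/PV/Pn].
Qed.

(** Additivity is assumed only on a subgroup: in the model, [cB] and [cC] are additive where [cx]
    vanishes but not everywhere. *)
Variables (P : set G) (c : G -> int).
Hypothesis sgP : is_subgroup P.
Hypothesis cM : forall g h, P g -> P h -> c (g * h) = (c g + c h)%R.

Lemma additive_on1 : c 1 = 0%R.
Proof. by have [P1 _ _] := sgP; have := cM P1 P1; rewrite mulg1; lia. Qed.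

Lemma additive_onV g : P g -> c g^-1 = (- c g)%R.
Proof.
have [_ _ PV] := sgP => Pg.
by have := cM Pg (PV _ Pg); rewrite mulgV additive_on1; lia.
Qed.

Lemma additive_onX g k : P g -> c (expgz g k) = (k * c g)%R.
Proof.
move=> Pg; elim/int_ind: k => [|n IH|n IH]; first by rewrite mul0r additive_on1.
  have -> : Posz n.+1 = (Posz n + 1)%R by lia.
  by rewrite expgzS cM ?IH ?mulrDl ?mul1r 1?addrC //; exact: subgroup_expgz.
have := cM Pg (subgroup_expgz (- Posz n.+1)%R sgP Pg).
rewrite -expgzS (_ : (- Posz n.+1 + 1 = - Posz n)%R); last lia.
by rewrite IH -addn1 PoszD => e; rewrite -[LHS](addKr (c g)) -e; ring.
Qed.

End IntegerPowers.

Section GroupMorphisms.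
Variables (G H : groupType) (f : G -> H).
Hypothesis fM : {morph f : g h / g * h}.

Lemma morph1 : f 1 = 1.
Proof. by apply: (mulgI (f 1)); rewrite -fM !mulg1. Qed.

Lemma morphV g : f g^-1 = (f g)^-1.
Proof. by apply: (mulgI (f g)); rewrite -fM !mulgV morph1. Qed.

Lemma morph_expgz g k : f (expgz g k) = expgz (f g) k.
Proof.
apply: (expgz_unique (f := fun k => f (expgz g k))); first exact: morph1.
by move=> i; rewrite expgzS fM.
Qed.

Lemma morph_comm g h : f (comm g h) = comm (f g) (f h).
Proof. by rewrite /comm !fM !morphV. Qed.

(** By induction, the preimage of the next term for [H] is a subgroup containing the commutators
    that generate the next term for [G]. *)
Lemma morph_Gamma i g : Gamma G i g -> Gamma H i (f g).
Proof.
elim: i g => [|[|i] IH] //= g; rewrite -/(Gamma G i.+1) -/(Gamma H i.+1) in IH *.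
have [C1 CM CV] := generated_subgroup
  [set c | exists a b, [/\ Gamma H i.+1 a, setT b & c = comm a b]].
move: g; apply: smallest_sub.
  split=> /= [|a b Ca Cb|a Ca]; first by rewrite morph1.
    by rewrite fM; exact: CM.
  by rewrite morphV; exact: CV.
move=> _ [a [b [Ca _ ->]]] /= P [_ sP]; apply: sP.
by exists (f a), (f b); split=> //; [exact: IH|exact: morph_comm].
Qed.

End GroupMorphisms.

Lemma inj_seq_infinite T (A : set T) (u : nat -> T) :
  injective u -> (forall k, A (u k)) -> infinite_set A.
Proof.
move=> uI Au; apply/infiniteP; rewrite -(card_le_eql (inj_card_eq (in2W uI))).
by apply: subset_card_le => _ [k _ <-].
Qed.

(** * Polycyclic coordinates *)

Section Coordinates.
Variables (G : groupType) (m : nat) (c : nat -> G -> int).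

(** Coordinates are numbered from the bottom of the series: stage 0 makes all of them vanish, stage
    [m] none. Under the hypotheses below, [c i] maps stage [i.+1] onto the integers with kernel
    stage [i]. *)
Definition coord_stage i : set G :=
  [set g | forall j, (i <= j < m)%N -> c j g = 0%R].

Hypothesis cM : forall i g h, (i < m)%N ->
  coord_stage i.+1 g -> coord_stage i.+1 h -> c i (g * h) = (c i g + c i h)%R.
Hypothesis c_onto : forall i, (i < m)%N ->
  exists2 g, coord_stage i.+1 g & c i g = 1%R.
Hypothesis c_eq1 : forall g, coord_stage 0 g -> g = 1.

Lemma coord_stage_last : coord_stage m = setT.
Proof. by apply/seteqP; split=> // g _ j; lia. Qed.

Lemma coord_stageS i g : (i < m)%N ->
  coord_stage i g <-> coord_stage i.+1 g /\ c i g = 0%R.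
Proof.
move=> im; split=> [Sg|[Sg cg] j /andP[ij jm]].
  by split=> [j /andP[ij jm]|]; apply: Sg; lia.
by move: ij; rewrite leq_eqVlt => /orP[/eqP <- //|ij]; apply: Sg; lia.
Qed.

(** The induction descends because stage [i] is known to be a subgroup only as the kernel of [c i]
    on the subgroup [i.+1]. *)
Lemma coord_stage_ind (Q : nat -> Prop) :
  Q m -> (forall i, (i < m)%N -> Q i.+1 -> Q i) -> forall i, (i <= m)%N -> Q i.
Proof.
move=> Qm QS i im; rewrite -(subKn im); elim: (m - i)%N (leq_subr i m) => [|k IH] km.
  by rewrite subn0.
have e : ((m - k.+1).+1 = m - k)%N by lia.
by apply: QS; rewrite ?e; [lia|apply: IH; lia].
Qed.

Lemma coord_stage_subgroup i : (i <= m)%N -> is_subgroup (coord_stage i).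
Proof.
move: i; apply: coord_stage_ind => [|i im sgS]; first by rewrite coord_stage_last; split.
have cMi g h := @cM i g h im; have [S1 SM SV] := sgS.
split=> [|a b|a].
- by apply/(coord_stageS _ im); split=> //; exact: additive_on1 sgS cMi.
- move=> /(coord_stageS _ im)[Sa ca] /(coord_stageS _ im)[Sb cb].
  apply/(coord_stageS _ im); split; first exact: SM.
  by rewrite cMi // ca cb.
- move=> /(coord_stageS _ im)[Sa ca].
  apply/(coord_stageS _ im); split; first exact: SV.
  by rewrite (additive_onV sgS cMi) // ca oppr0.
Qed.

Lemma coord_expgz i g k : (i < m)%N -> coord_stage i.+1 g ->
  c i (expgz g k) = (k * c i g)%R.
Proof.
by move=> im; apply: (additive_onX (coord_stage_subgroup im)) => ? ?; exact: cM.
Qed.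

(** One step of the reduction to normal form: dividing by the right power of [g] clears the
    coordinate [c i]. *)
Lemma coord_expgzV_stage i g h : (i < m)%N ->
  coord_stage i.+1 g -> c i g = 1%R -> coord_stage i.+1 h ->
  coord_stage i ((expgz g (c i h))^-1 * h).
Proof.
move=> im Sg cg Sh; have sgS := coord_stage_subgroup im; have [_ SM SV] := sgS.
have Sk k : coord_stage i.+1 (expgz g k) := subgroup_expgz k sgS Sg.
apply/(coord_stageS _ im); split; first by apply: SM => //; exact: SV.
rewrite cM //; last exact: SV.
rewrite (additive_onV sgS) //; last by move=> ? ?; exact: cM.
by rewrite coord_expgz // cg mulr1 addNr.
Qed.

Lemma coord_stage_normal i : (i < m)%N ->
  normal_in (coord_stage i) (coord_stage i.+1).
Proof.
move=> im; have sgS := coord_stage_subgroup im; have [_ SM SV] := sgS.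
split=> //; first exact/coord_stage_subgroup/ltnW.
  by move=> g /(coord_stageS _ im)[].
move=> g a Sg /(coord_stageS _ im)[Sa ca]; apply/(coord_stageS _ im).
have Sv := SV _ Sg; have Sga := SM _ _ Sg Sa; split; first exact: SM.
rewrite (cM im Sga Sv) (cM im Sg Sa).
rewrite (additive_onV sgS) //; last by move=> ? ?; exact: cM.
by rewrite ca addr0 addrN.
Qed.

(** The powers of an element with [c i] equal to 1 are separated by [c i], which is constant on
    cosets of its kernel. *)
Lemma coord_stage_cosets i : (i < m)%N ->
  infinite_set (cosets (coord_stage i.+1) (coord_stage i)).
Proof.
move=> im; have [g Sg cg] := c_onto im.
have sgS := coord_stage_subgroup im; have [S1 _ _] := coord_stage_subgroup (ltnW im).
have Sn n : coord_stage i.+1 (expgz g (Posz n)) := subgroup_expgz _ sgS Sg.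
pose u n := [set expgz g (Posz n) * k | k in coord_stage i].
apply: (@inj_seq_infinite _ _ u) => [j k ujk|k]; last by exists (expgz g (Posz k)).
have: u k (expgz g (Posz j)) by rewrite -ujk; exists 1; rewrite ?mulg1.
move=> [h /(coord_stageS _ im)[Sh ch] /(congr1 (c i))].
by rewrite cM // !coord_expgz // ch cg !mulr1 addr0 => -[].
Qed.

Lemma coord_hirsch : has_hirsch_length G m.
Proof.
exists coord_stage, m; split; last first.
  (* All [m] factors are infinite, so the count is the size of ['I_m]. *)
  apply/eqP; rewrite -[eqbRHS]card_ord; apply/eqP/eq_card => i.
  by rewrite !inE; apply/asboolP; exact: coord_stage_cosets.
split; last move=> i im.
- apply/seteqP; split=> [g /c_eq1 //|_ ->].
  by have [] := coord_stage_subgroup (leq0n m).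
- exact: coord_stage_last.
- split; first exact: coord_stage_normal.
  have [g Sg cg] := c_onto im; exists g => // h Sh; exists (c i h).
  exact: coord_expgzV_stage.
Qed.

(** From the top stage down, k * c i g = 0 with k positive forces each coordinate of [g] to
    vanish. *)
Lemma coord_torsion_free : torsion_free G.
Proof.
move=> g k k0 gk; apply: c_eq1.
move: (0%N) (leq0n m); apply: coord_stage_ind => [|i im Sg].
  by rewrite coord_stage_last.
apply/(coord_stageS _ im); split=> //.
have /esym/eqP := coord_expgz (Posz k) im Sg.
rewrite /= gk (additive_on1 (coord_stage_subgroup im)); last by move=> ? ?; exact: cM.
by rewrite mulf_eq0 => /orP[|/eqP //]; lia.
Qed.

(** One element with coordinate 1 per stage suffices: clearing the coordinates from the top writes
    every element in terms of these. *)
Lemma coord_finitely_generated : finitely_generated G.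
Proof.
have /choice[w wP] : forall i : 'I_m,
    exists g, coord_stage i.+1 g /\ c i g = 1%R.
  by move=> i; have [g] := c_onto (ltn_ord i); exists g.
pose l := [seq w i | i <- enum 'I_m]; exists l; apply/seteqP; split=> // g _.
have sgL := generated_subgroup [set` l]; have [L1 LM LV] := sgL.
suff sub i : (i <= m)%N -> coord_stage i `<=` generated [set` l].
  by apply: (sub m) => //; rewrite coord_stage_last.
elim: i => [_ h /c_eq1 -> //|i IH im h Sh].
have [Sw cw] := wP (Ordinal im).
rewrite -(mulVKg (expgz (w (Ordinal im)) (c i h)) h).
apply: LM; last by apply: IH (ltnW im) _ _; exact: coord_expgzV_stage.
apply: (subgroup_expgz _ sgL) => P [_ sP]; apply: sP => /=.
by rewrite map_f // mem_enum.
Qed.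

End Coordinates.

(** * A coordinate model of G *)

Definition tri (a : int) : int := ((a * (a - 1))%R %/ 2)%Z.

Lemma triE a : (a * (a - 1) = 2 * tri a)%R.
Proof.
have d2 : (2 %| (a * (a - 1))%R)%Z.
  have [q [->|->]] : exists q, (a = q * 2 \/ a = q * 2 + 1)%R.
    by exists (a %/ 2)%Z; lia.
  - by rewrite mulrAC dvdz_mull.
  - by rewrite addrK mulrA dvdz_mull.
by rewrite [RHS]mulrC divzK.
Qed.

(** The failure of additivity, a * b, is exactly the term that associativity of [model_mul] needs in
    the last coordinate. *)
Lemma triD a b : (tri (a + b) = tri a + tri b + a * b)%R.
Proof.
have := triE (a + b); have := triE a; have := triE b => eb ea eab.
suff: (2 * tri (a + b) = 2 * (tri a + tri b + a * b))%R by lia.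
by rewrite -eab !mulrDr -ea -eb; ring.
Qed.

Lemma tri0 : tri 0%R = 0%R. Proof. by []. Qed.

Lemma tri1 : tri 1%R = 0%R. Proof. by []. Qed.

(* (a, b, c, d) stands for C^d B^c y^b x^a, where C = [B, x]. Conjugation by x
   fixes C and sends y to B y and B to C^-1 B; the binomial coefficient tri a
   comes from the a-th power of this unipotent map. *)
Definition model := (int * int * int * int)%type.

HB.instance Definition _ := Choice.on model.

Definition model_one : model := (0, 0, 0, 0)%R.

Definition model_mul (u v : model) : model :=
  let: (a, b, c, d) := u in let: (a', b', c', d') := v in
  (a + a', b + b', c + c' + a * b', d + d' - a * c' - tri a * b')%R.

Definition model_inv (u : model) : model :=
  let: (a, b, c, d) := u in
  (- a, - b, a * b - c, tri (- a) * b - a * c - d)%R.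

Lemma model_eq (a b c d a' b' c' d' : int) :
  a = a' -> b = b' -> c = c' -> d = d' -> (a, b, c, d) = (a', b', c', d') :> model.
Proof. by move=> -> -> -> ->. Qed.

Lemma model_mulA : associative model_mul.
Proof.
move=> [[[a b] c] d] [[[a' b'] c'] d'] [[[a'' b''] c''] d''].
by apply: model_eq; rewrite ?triD; ring.
Qed.

Lemma model_mul1 : left_id model_one model_mul.
Proof. by move=> [[[a b] c] d]; apply: model_eq; rewrite ?tri0; ring. Qed.

Lemma model_1mul : right_id model_one model_mul.
Proof. by move=> [[[a b] c] d]; apply: model_eq; ring. Qed.

Lemma model_mulV : left_inverse model_one model_inv model_mul.
Proof. by move=> [[[a b] c] d]; apply: model_eq; ring. Qed.

Lemma model_Vmul : right_inverse model_one model_inv model_mul.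
Proof.
move=> [[[a b] c] d]; apply: model_eq; try ring.
(* Opposite arguments give tri a + tri (- a) = a * a. *)
have := triD a (- a)%R; rewrite addrN tri0 => /esym/eqP.
rewrite addr_eq0 mulrN opprK => /eqP e.
have -> : tri a = (a * a - tri (- a))%R by rewrite -e; ring.
ring.
Qed.

HB.instance Definition _ := isGroup.Build model
  model_mulA model_mul1 model_1mul model_mulV model_Vmul.

Definition cx (u : model) : int := u.1.1.1.
Definition cy (u : model) : int := u.1.1.2.
Definition cB (u : model) : int := u.1.2.
Definition cC (u : model) : int := u.2.

Lemma model_ext (u v : model) :
  cx u = cx v -> cy u = cy v -> cB u = cB v -> cC u = cC v -> u = v.
Proof.
by case: u v => [[[a b] c] d] [[[a' b'] c'] d']; exact: model_eq.
Qed.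

Lemma cxM : {morph cx : u v / u * v >-> (u + v)%R}.
Proof. by move=> [[[a b] c] d] [[[a' b'] c'] d']. Qed.

Lemma cyM : {morph cy : u v / u * v >-> (u + v)%R}.
Proof. by move=> [[[a b] c] d] [[[a' b'] c'] d']. Qed.

Lemma cBM (u v : model) : cB (u * v) = (cB u + cB v + cx u * cy v)%R.
Proof. by move: u v => [[[a b] c] d] [[[a' b'] c'] d']. Qed.

Lemma cCM (u v : model) :
  cC (u * v) = (cC u + cC v - cx u * cB v - tri (cx u) * cy v)%R.
Proof. by move: u v => [[[a b] c] d] [[[a' b'] c'] d']. Qed.

(** This inverse-free equation determines the commutator, so its coordinates can be read off by
    comparing the two sides. *)
Lemma comm_mul (G : groupType) (g h : G) : comm g h * (h * g) = g * h.
Proof. by rewrite /comm !mulgA !mulgVK. Qed.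

Lemma comm_eq1 (G : groupType) (g h : G) : commute g h -> comm g h = 1.
Proof. by rewrite /comm => ->; rewrite mulgK mulgV. Qed.

Lemma commP (G : groupType) (g h k : G) : k * (h * g) = g * h -> comm g h = k.
Proof. by rewrite -[RHS]comm_mul => /mulIg. Qed.

Lemma cx_comm (u v : model) : cx (comm u v) = 0%R.
Proof. by have := congr1 cx (comm_mul u v); rewrite !cxM; lia. Qed.

Lemma cy_comm (u v : model) : cy (comm u v) = 0%R.
Proof. by have := congr1 cy (comm_mul u v); rewrite !cyM; lia. Qed.

Lemma cB_comm (u v : model) : cB (comm u v) = (cx u * cy v - cx v * cy u)%R.
Proof.
have := congr1 cB (comm_mul u v); rewrite !cBM cx_comm mul0r addr0 => e.
by lia.
Qed.

(** The hypotheses compare [cB] and [cC] of the two products; [cx] and [cy] agree by additivity. *)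
Lemma model_commute (u v : model) :
  (cx u * cy v = cx v * cy u -> cx u * cB v + tri (cx u) * cy v =
   cx v * cB u + tri (cx v) * cy u -> commute u v)%R.
Proof.
move=> eB eC; apply: model_ext; rewrite ?cxM ?cyM ?cBM ?cCM; lia.
Qed.

Lemma commute_cB (u v : model) : commute u v -> (cx u * cy v = cx v * cy u)%R.
Proof. by move=> /(congr1 cB); rewrite !cBM; lia. Qed.

Lemma commute_cC (u v : model) : commute u v ->
  (cx u * cB v + tri (cx u) * cy v = cx v * cB u + tri (cx v) * cy u)%R.
Proof. by move=> /(congr1 cC); rewrite !cCM; lia. Qed.

Definition mx : model := (1, 0, 0, 0)%R.
Definition my : model := (0, 1, 0, 0)%R.
Definition mB : model := (0, 0, 1, 0)%R.
Definition mC : model := (0, 0, 0, 1)%R.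

Lemma comm_mx_my : comm mx my = mB. Proof. exact: commP. Qed.

Lemma comm_mB_mx : comm mB mx = mC. Proof. exact: commP. Qed.

Lemma comm_mB_my : comm mB my = 1. Proof. exact: commP. Qed.

Lemma expgz_mx k : expgz mx k = (k, 0, 0, 0)%R.
Proof.
rewrite -(@expgz_unique _ (fun k => (k, 0, 0, 0)%R : model)) // => i.
by apply: model_eq; rewrite ?tri1; ring.
Qed.

Lemma expgz_my k : expgz my k = (0, k, 0, 0)%R.
Proof.
rewrite -(@expgz_unique _ (fun k => (0, k, 0, 0)%R : model)) // => i.
by apply: model_eq; rewrite ?tri0; ring.
Qed.

Lemma expgz_mB k : expgz mB k = (0, 0, k, 0)%R.
Proof.
rewrite -(@expgz_unique _ (fun k => (0, 0, k, 0)%R : model)) // => i.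
by apply: model_eq; rewrite ?tri0; ring.
Qed.

Lemma expgz_mC k : expgz mC k = (0, 0, 0, k)%R.
Proof.
rewrite -(@expgz_unique _ (fun k => (0, 0, 0, k)%R : model)) // => i.
by apply: model_eq; rewrite ?tri0; ring.
Qed.

Lemma model_normal_form a b c d :
  expgz mC d * expgz mB c * expgz my b * expgz mx a = (a, b, c, d) :> model.
Proof.
rewrite expgz_mC expgz_mB expgz_my expgz_mx.
by apply: model_eq; rewrite /= ?tri0; ring.
Qed.

Lemma Gamma_sub (G : groupType) i (P : set G) : is_subgroup P ->
  (forall g h, Gamma G i.+1 g -> P (comm g h)) -> Gamma G i.+2 `<=` P.
Proof. by move=> sgP cP; apply: smallest_sub => // _ [g [h [Gg _ ->]]]; exact: cP. Qed.

Lemma Gamma_abelian (G : groupType) i :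
  (forall g h : G, commute g h) -> Gamma G i.+2 `<=` [set 1].
Proof.
move=> abG; apply: Gamma_sub => [|g h _]; last exact: comm_eq1.
by split=> [|a b -> ->|a ->] //; rewrite ?mulg1 ?invg1.
Qed.

(** The second term kills [cx] and [cy], the third also [cB]; what remains is central. *)
Lemma Gamma4_model : Gamma model 4 `<=` [set 1].
Proof.
(* Kernels are intersected one at a time, since [cB] becomes additive only once [cx] vanishes. *)
have kernel (c : model -> int) P : is_subgroup P ->
    (forall g h, P g -> P h -> c (g * h) = (c g + c h)%R) ->
    is_subgroup [set g | P g /\ c g = 0%R].
  move=> sgP cM; have [P1 PM PV] := sgP.
  split=> [|a b [Pa ca] [Pb cb]|a [Pa ca]] /=.
  - by split=> //; exact: (additive_on1 sgP cM).
  - by split; [exact: PM|rewrite cM // ca cb].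
  - by split; [exact: PV|rewrite (additive_onV sgP cM) // ca oppr0].
have sgx : is_subgroup [set u : model | setT u /\ cx u = 0%R].
  by apply: kernel => [|g h _ _]; [split|rewrite cxM].
have sgy : is_subgroup [set u : model | (setT u /\ cx u = 0%R) /\ cy u = 0%R].
  by apply: (kernel cy _ sgx) => g h _ _; rewrite cyM.
have sgB : is_subgroup
    [set u : model | ((setT u /\ cx u = 0) /\ cy u = 0) /\ cB u = 0]%R.
  apply: (kernel cB _ sgy) => g h [[_ gx] gy] [[_ hx] hy].
  by rewrite cBM gx mul0r addr0.
have G2 : Gamma model 2 `<=` [set u | (setT u /\ cx u = 0%R) /\ cy u = 0%R].
  by apply: Gamma_sub => // g h _; rewrite /= cx_comm cy_comm.
have G3 : Gamma model 3 `<=`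
    [set u | ((setT u /\ cx u = 0) /\ cy u = 0) /\ cB u = 0]%R.
  apply: Gamma_sub => // g h /G2[[_ gx] gy] /=.
  by rewrite cx_comm cy_comm cB_comm gx gy mul0r mulr0.
apply: Gamma_sub => [|g h /G3[[[_ gx] gy] gB]].
  by split=> [|a b -> ->|a ->] //; rewrite ?mulg1 ?invg1.
by apply/comm_eq1/model_commute; rewrite gx gy ?gB ?tri0 !mul0r !mulr0.
Qed.

(** * Automorphisms and twisted conjugacy *)

Lemma unit_int (a b : int) : (a * b = 1 -> a = 1 \/ a = -1)%R.
Proof.
rewrite mulrC => /intUnitRing.unitzPl.
by rewrite qualifE /= => /orP[/eqP|/eqP]; [left|right].
Qed.

Lemma cx_expgz (u : model) k : cx (expgz u k) = (k * cx u)%R.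
Proof.
by apply: (additive_onX (P := setT)) => [|? ? _ _|//]; [split|exact: cxM].
Qed.

Lemma cy_expgz (u : model) k : cy (expgz u k) = (k * cy u)%R.
Proof.
by apply: (additive_onX (P := setT)) => [|? ? _ _|//]; [split|exact: cyM].
Qed.

Lemma cxV (u : model) : cx u^-1 = (- cx u)%R.
Proof. by case: u => [[[a b] c] d]. Qed.

Lemma cyV (u : model) : cy u^-1 = (- cy u)%R.
Proof. by case: u => [[[a b] c] d]. Qed.

Lemma cBV (u : model) : cB u^-1 = (cx u * cy u - cB u)%R.
Proof. by case: u => [[[a b] c] d]. Qed.

Lemma cB_expgz (u : model) k : cx u = 0%R -> cB (expgz u k) = (k * cB u)%R.
Proof.
apply: (additive_onX (P := [set v | cx v = 0%R])) => [|v w vx wx].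
  by split=> [//|v w /= vx wx|v /= vx]; rewrite ?cxM ?cxV ?vx ?wx.
by rewrite cBM vx mul0r addr0.
Qed.

(** Each [u l] lies in its own class, so two equal classes yield a twisted conjugation between their
    representatives. *)
Lemma infinite_reidemeister (G : groupType) (phi : G -> G) (u : nat -> G) :
  {morph phi : g h / g * h} ->
  (forall k l s, s * u k * (phi s)^-1 = u l -> k = l) ->
  infinite_set (reidemeister_classes phi).
Proof.
move=> phiM uI.
apply: (@inj_seq_infinite _ _ (fun k => reidemeister_class phi (u k))).
  move=> k l ukl; have: reidemeister_class phi (u k) (u l).
    by rewrite ukl; exists 1 => //; rewrite (morph1 phiM) invg1 mulg1 mul1g.
  by move=> [s _]; exact: uI.
by move=> k; exists (u k).
Qed.

Lemma mx_coords : ((cx mx = 1%R) * (cy mx = 0%R) * (cB mx = 0%R))%type. Proof. by []. Qed.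

Lemma my_coords : ((cx my = 0%R) * (cy my = 1%R) * (cB my = 0%R))%type. Proof. by []. Qed.

Lemma mB_coords : ((cx mB = 0%R) * (cy mB = 0%R) * (cB mB = 1%R))%type. Proof. by []. Qed.

(** * Automorphisms of central extensions of the model *)

Section CentralExtensionOfModel.
Variables (H : groupType) (f : H -> model) (x y : H).
Hypothesis fM : {morph f : g h / g * h}.
Hypothesis fx : f x = mx.
Hypothesis fy : f y = my.
(** Commutation is detected in the model, so the kernel of [f] is central. For the product with Z^n,
    [f] forgets the abelian factor. *)
Hypothesis f_commute : forall g h, commute (f g) (f h) -> commute g h.

Let X g := cx (f g).
Let Y g := cy (f g).
Let B g := cB (f g).

Let fC := morph_comm fM.

Let fcommute g h : commute g h -> commute (f g) (f h).
Proof. by move=> gh; rewrite /commute -!fM gh. Qed.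

(** Commutators have zero [cx] and [cy], so only [X g] times their [cB] obstructs commutation; the
    commutator of [x] and [y] detects it. The right side uses the group law alone, hence is
    preserved by automorphisms. *)
Lemma centralizes_commutatorsP g :
  X g = 0%R <-> forall s t, commute g (comm s t).
Proof.
split=> [Xg s t|cg].
  by apply/f_commute/model_commute;
    rewrite -/(X g) Xg fC cx_comm ?cy_comm ?tri0 !mul0r.
have := commute_cC (fcommute (cg x y)).
by rewrite fC fx fy comm_mx_my -/(X g) !mB_coords tri0; lia.
Qed.

Lemma second_centerP g :
  (X g = 0 /\ Y g = 0)%R <-> forall s t, commute (comm g s) t.
Proof.
split=> [[Xg Yg] s t|cg].
  apply/f_commute/model_commute; rewrite fC cx_comm cy_comm ?cB_comm.
    by rewrite mul0r mulr0.
  by rewrite -/(X g) -/(Y g) Xg Yg tri0 !(mul0r, mulr0).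
(* Since this commutator has zero [cx] and [cy], commuting with [x] leaves only its [cB], which must
   vanish. *)
have cBg s : cB (comm (f g) (f s)) = 0%R.
  have /fcommute/commute_cC := cg s x.
  by rewrite fC fx cx_comm cy_comm !mx_coords tri0 tri1; lia.
move: (cBg x) (cBg y); rewrite !cB_comm fx fy -/(X g) -/(Y g) !mx_coords !my_coords; lia.
Qed.

(** Commuting with [y] forces [X g] to vanish, commuting with [x] the other two coordinates. *)
Lemma centerP g :
  [/\ X g = 0, Y g = 0 & B g = 0]%R <-> forall s, commute g s.
Proof.
split=> [[Xg Yg Bg] s|cg].
  by apply/f_commute/model_commute;
    rewrite -/(X g) -/(Y g) -?/(B g) Xg Yg ?Bg ?tri0 !(mul0r, mulr0).
have := commute_cB (fcommute (cg x)); have := commute_cC (fcommute (cg x)).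
have := commute_cB (fcommute (cg y)).
by rewrite fx fy -/(X g) -/(Y g) -/(B g) !mx_coords !my_coords tri1; split; lia.
Qed.

Section Automorphism.
Variable phi : H -> H.
Hypothesis phiM : {morph phi : g h / g * h}.
Hypothesis phi_bij : bijective phi.

Let phi_commute g h : commute g h -> commute (phi g) (phi h).
Proof. by move=> gh; rewrite /commute -!phiM gh. Qed.

Let phiC := morph_comm phiM.

Let phi_onto g : exists h, phi h = g.
Proof. by have [psi _ phiK] := phi_bij; exists (psi g). Qed.

(** Surjectivity of [phi] lets every test commutator be written as the image of a commutator. *)
Lemma aut_cx0 g : X g = 0%R -> X (phi g) = 0%R.
Proof.
move=> /centralizes_commutatorsP cg; apply/centralizes_commutatorsP => s t.
have [[s' <-] [t' <-]] := (phi_onto s, phi_onto t).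
by rewrite -phiC; exact: phi_commute.
Qed.

Lemma aut_cxy0 g : (X g = 0 /\ Y g = 0 -> X (phi g) = 0 /\ Y (phi g) = 0)%R.
Proof.
move=> /second_centerP cg; apply/second_centerP => s t.
have [[s' <-] [t' <-]] := (phi_onto s, phi_onto t).
by rewrite -phiC; exact: phi_commute.
Qed.

Lemma aut_center g : ([/\ X g = 0, Y g = 0 & B g = 0] ->
  [/\ X (phi g) = 0, Y (phi g) = 0 & B (phi g) = 0])%R.
Proof.
move=> /centerP cg; apply/centerP => s.
by have [s' <-] := phi_onto s; exact: phi_commute.
Qed.

(** On the coordinates [X] and [Y], [phi] will act by a triangular matrix with diagonal entries [p],
    [q] (the signs e_x, e_y) and off-diagonal entry [t]. *)
Let p := X (phi x).
Let t := Y (phi x).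
Let q := Y (phi y).

Let XM g h : X (g * h) = (X g + X h)%R. Proof. by rewrite /X fM cxM. Qed.
Let YM g h : Y (g * h) = (Y g + Y h)%R. Proof. by rewrite /Y fM cyM. Qed.
Let BM g h : B (g * h) = (B g + B h + X g * Y h)%R.
Proof. by rewrite /B fM cBM. Qed.
Let XV g : X g^-1 = (- X g)%R. Proof. by rewrite /X (morphV fM) cxV. Qed.
Let YV g : Y g^-1 = (- Y g)%R. Proof. by rewrite /Y (morphV fM) cyV. Qed.
Let BV g : B g^-1 = (X g * Y g - B g)%R.
Proof. by rewrite /B (morphV fM) cBV. Qed.
Let XX g k : X (expgz g k) = (k * X g)%R.
Proof. by rewrite /X (morph_expgz fM) cx_expgz. Qed.
Let YX g k : Y (expgz g k) = (k * Y g)%R.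
Proof. by rewrite /Y (morph_expgz fM) cy_expgz. Qed.
Let BX g k : X g = 0%R -> B (expgz g k) = (k * B g)%R.
Proof. by move=> Xg; rewrite /B (morph_expgz fM) cB_expgz. Qed.

Let Xx : X x = 1%R. Proof. by rewrite /X fx. Qed.
Let Yx : Y x = 0%R. Proof. by rewrite /Y fx. Qed.
Let Xy : X y = 0%R. Proof. by rewrite /X fy. Qed.
Let Yy : Y y = 1%R. Proof. by rewrite /Y fy. Qed.

(** Split off a power of [x]; the remainder has zero [X], and so has its image. The next two
    formulas do the same modulo the second center and the center. *)
Lemma aut_cx g : X (phi g) = (p * X g)%R.
Proof.
rewrite -{1}(mulVKg (expgz x (X g)) g) phiM XM (morph_expgz phiM) XX.
rewrite [X (phi (_ * _))]aut_cx0 ?addr0 1?mulrC //.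
by rewrite XM XV XX Xx; lia.
Qed.

Lemma aut_cy g : Y (phi g) = (t * X g + q * Y g)%R.
Proof.
pose w := expgz x (X g) * expgz y (Y g).
have [_ Yk] : (X (phi (w^-1 * g)) = 0 /\ Y (phi (w^-1 * g)) = 0)%R.
  by apply: aut_cxy0; rewrite XM YM XV YV /w XM YM !XX !YX Xx Xy Yx Yy; lia.
rewrite -{1}(mulVKg w g) phiM YM Yk addr0 /w phiM YM !(morph_expgz phiM) !YX.
by rewrite -/t -/q; lia.
Qed.

(** Modulo the center, [g] is a power of the commutator of [x] and [y], whose image has [cB] equal
    to the determinant p * q. *)
Lemma aut_cB g : (X g = 0 -> Y g = 0 -> B (phi g) = p * q * B g)%R.
Proof.
move=> Xg Yg; pose z := comm x y.
have Xz : X z = 0%R by rewrite /X /z fC cx_comm.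
have Yz : Y z = 0%R by rewrite /Y /z fC cy_comm.
have Bz : B z = 1%R by rewrite /B /z fC fx fy comm_mx_my.
pose w := expgz z (B g).
have [Xk Yk Bk] : [/\ X (phi (w^-1 * g)) = 0, Y (phi (w^-1 * g)) = 0
    & B (phi (w^-1 * g)) = 0]%R.
  by apply: aut_center; rewrite XM YM BM XV YV BV XX YX BX // Xz Yz Bz; split; lia.
rewrite -{1}(mulVKg w g) phiM BM Yk Bk mulr0 !addr0 (morph_expgz phiM) BX.
  rewrite phiC /B fC cB_comm -/(X _) -/(X _) -/(Y _) -/(Y _).
  by rewrite [X (phi y)]aut_cx0 // -/p -/q; lia.
by rewrite phiC /X fC cx_comm.
Qed.

Lemma aut_infinite_reidemeister : infinite_set (reidemeister_classes phi).
Proof.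
(* A preimage of [x] provides an integer inverse of [p]. *)
have pS : (p = 1 \/ p = -1)%R.
  by have [x' x'P] := phi_onto x; apply: (@unit_int p (X x')); rewrite -aut_cx x'P.
have qS : (q = 1 \/ q = -1)%R.
  have [y' y'P] := phi_onto y; apply: (@unit_int q (Y y')).
  (* As [p] is a unit, the preimage of [y] has zero [X], so its [Y] inverts [q]. *)
  have: X (phi y') = 0%R by rewrite y'P.
  by rewrite aut_cx => pX; have := aut_cy y'; rewrite y'P Yy; case: pS pX => ->; lia.
case: pS => [p1|pN1].
  (* With p = 1 the contributions of [s] to [X] cancel. *)
  apply: (@infinite_reidemeister _ _ (fun k => expgz x (Posz k))) => // k l s.
  by move=> /(congr1 X); rewrite !XM XV !XX Xx aut_cx p1; lia.
case: qS => [q1|qN1].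
  (* On the abelianization 2 Y + t X is fixed by phi: 2 (t X + Y) - t X. *)
  apply: (@infinite_reidemeister _ _ (fun k => expgz y (Posz k))) => // k l s e.
  have := congr1 Y e; have := congr1 X e.
  by rewrite !XM !YM XV YV !XX !YX Xy Yy aut_cx aut_cy pN1 q1; lia.
(* With p = q = -1, comparing [X] and then [Y] gives 2 X s = 0 and 2 Y s = 0. So [s] is in the
   second center, where [phi] preserves [B] because p * q = 1, and its contributions to [B]
   cancel. *)
apply: (@infinite_reidemeister _ _ (fun k => expgz (comm x y) (Posz k))) => // k l s e.
have Xz : X (comm x y) = 0%R by rewrite /X fC cx_comm.
have Yz : Y (comm x y) = 0%R by rewrite /Y fC cy_comm.
have Xs : X s = 0%R.
  by have := congr1 X e; rewrite !XM XV !XX Xz aut_cx pN1; lia.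
have Ys : Y s = 0%R.
  by have := congr1 Y e; rewrite !YM YV !YX Yz aut_cy qN1 Xs; lia.
have := congr1 B e; rewrite !BM BV !XM !XX !YX !YV !BX // aut_cx aut_cy (aut_cB Xs Ys).
rewrite Xs Ys Xz Yz pN1 qN1 /B fC fx fy comm_mx_my mB_coords; lia.
Qed.

End Automorphism.

End CentralExtensionOfModel.

(** * The presentation of G *)

Section FreeGroupLift.
Variables (T : choiceType) (G : groupType) (v : T -> G).

Definition letter_value (l : T * bool) : G := if l.2 then (v l.1)^-1 else v l.1.

Definition word_value (u : word T) : G := foldr (fun l g => letter_value l * g) 1 u.

Lemma word_value_cat u w : word_value (u ++ w) = word_value u * word_value w.
Proof. by elim: u => [|l u IH] /=; rewrite ?mul1g // IH mulgA. Qed.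

Lemma word_value_equiv u w : free_equiv u w -> word_value u = word_value w.
Proof.
elim=> {u w} [u w a e|//|u w _ -> //|u w z _ -> _ -> //].
rewrite !word_value_cat /=; congr (_ * _).
by case: e; rewrite /letter_value /= mulgA ?mulVg ?mulgV mul1g.
Qed.

Definition free_lift (p : free_group T) : G := word_value (repr p).

Lemma free_lift_pi u : free_lift (free_pi u) = word_value u.
Proof. by apply/word_value_equiv/free_piP; rewrite free_piK. Qed.

Lemma free_liftM : {morph free_lift : p q / p * q}.
Proof.
move=> p q; rewrite -[p]free_piK -[q]free_piK.
by rewrite -[_ * _]free_piM !free_lift_pi word_value_cat.
Qed.

Lemma free_lift_gen a : free_lift (free_gen a) = v a.
Proof. by rewrite free_lift_pi /= mulg1. Qed.

End FreeGroupLift.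

Section QuotientLift.
Variables (G H : groupType) (N : normalSubgroup G) (f : G -> H).
Hypothesis fM : {morph f : g h / g * h}.
Hypothesis fN : forall g, normal_set N g -> f g = 1.

Definition quotient_lift (u : quotient_group N) : H := f (repr u).

Lemma quotient_lift_pi g : quotient_lift (quotient_pi N g) = f g.
Proof.
have /fN : normal_set N (g^-1 * repr (quotient_pi N g)).
  by apply/quotient_piP; rewrite quotient_piK.
by rewrite fM (morphV fM) => /(congr1 (fun h => f g * h)); rewrite mulVKg mulg1.
Qed.

Lemma quotient_liftM : {morph quotient_lift : u w / u * w}.
Proof.
move=> u w; rewrite -[u]quotient_piK -[w]quotient_piK.
by rewrite -[_ * _]quotient_piM !quotient_lift_pi fM.
Qed.

End QuotientLift.

Lemma quotient_pi_eq1 (G : groupType) (N : normalSubgroup G) g :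
  normal_set N g -> quotient_pi N g = 1.
Proof.
move=> Ng; apply/esym/quotient_piP.
by rewrite invg1 mul1g.
Qed.

(** * Normal forms from the two relations *)

Section NormalForm.
Variables (G : groupType) (x y : G).
Let B := comm x y.
Let C := comm B x.
Hypothesis By : commute B y.
Hypothesis C_central : forall g, commute C g.

Definition normal_form a b c d : G :=
  expgz C d * expgz B c * expgz y b * expgz x a.

(** Moving [x] to the right conjugates each factor: [C] is fixed, [B] becomes [C^-1 * B] and [y]
    becomes [B * y]. Both products commute, so their powers split. *)
Lemma normal_form_mulx a b c d :
  x * normal_form a b c d = normal_form (a + 1)%R b (c + b)%R (d - c)%R.
Proof.
have xC : x * C * x^-1 = C by rewrite -(C_central x) mulgK.
have xB : x * B * x^-1 = C^-1 * B.
  by apply: (mulgI C); rewrite mulVKg mulgA (comm_mul B x) mulgK.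
have xy : x * y * x^-1 = B * y by rewrite /B /comm mulgVK.
have -> : x * normal_form a b c d = x * expgz C d * x^-1 *
    (x * expgz B c * x^-1) * (x * expgz y b * x^-1) * (x * expgz x a).
  by rewrite /normal_form !mulgA !mulgVK.
have CB : commute C^-1 B by exact/commute_sym/commuteV/commute_sym.
rewrite !expgzJ xC xB xy -expgzS (expgzMn _ CB) (expgzMn _ By) expVgz.
by rewrite /normal_form !expgzD !mulgA.
Qed.

Lemma normal_form_muly a b c d :
  y * normal_form a b c d = normal_form a (b + 1)%R c d.
Proof.
rewrite addrC /normal_form expgzD /= !mulgA; congr (_ * _ * _).
have yC : commute y (expgz C d) by exact/commute_expgz/commute_sym.
have yB : commute y (expgz B c) by exact/commute_expgz/commute_sym.
by rewrite yC -!mulgA yB.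
Qed.

Lemma normal_form_mulVx a b c d : x^-1 * normal_form a b c d =
  normal_form (a - 1)%R b (c - b)%R (d + (c - b))%R.
Proof.
apply: (mulgI x); rewrite mulVKg normal_form_mulx.
by congr normal_form; ring.
Qed.

Lemma normal_form_mulVy a b c d :
  y^-1 * normal_form a b c d = normal_form a (b - 1)%R c d.
Proof.
by apply: (mulgI y); rewrite mulVKg normal_form_muly; congr normal_form; ring.
Qed.

End NormalForm.

Definition By_pi (g : F2) : G_By := quotient_pi By_closure (quotient_pi Gamma4 g).

Lemma By_piM : {morph By_pi : g h / g * h}.
Proof.
by move=> g h; rewrite /By_pi [quotient_pi Gamma4 _]gmulfM [LHS]gmulfM.
Qed.

Lemma By_pi_onto u : exists g, By_pi g = u.
Proof. by exists (repr (repr u)); rewrite /By_pi !quotient_piK. Qed.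

Definition Gx : G_By := By_pi F2x.
Definition Gy : G_By := By_pi F2y.

Lemma By_comm g h : By_pi (comm g h) = comm (By_pi g) (By_pi h).
Proof. exact: (morph_comm By_piM). Qed.

Lemma commute_comm_eq1 (G : groupType) (g h : G) : comm g h = 1 -> commute g h.
Proof. by move=> gh; rewrite /commute -comm_mul gh mul1g. Qed.

Lemma By_relation : commute (comm Gx Gy) Gy.
Proof.
apply: commute_comm_eq1; rewrite /Gx /Gy -!By_comm.
by apply: quotient_pi_eq1 => P [_ sP]; exact: sP.
Qed.

Lemma By_class g : commute (comm (comm Gx Gy) Gx) g.
Proof.
have [h <-] := By_pi_onto g; apply: commute_comm_eq1; rewrite /Gx /Gy -!By_comm.
have mem i a b : Gamma F2 i.+1 a -> Gamma F2 i.+2 (comm a b).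
  by move=> Ga P [_ sP]; apply: sP; exists a, b.
rewrite /By_pi (@quotient_pi_eq1 _ Gamma4) //.
(* Three commutators lead from [Gamma F2 1], the whole group, to [Gamma F2 4]. *)
exact: (mem 2%N _ _ (mem 1%N _ _ (mem 0%N _ _ I))).
Qed.

(** Induction on a representing word: the normal forms contain 1 and are stable under left
    multiplication by each letter. *)
Lemma By_normal_form u : exists a b c d, u = normal_form Gx Gy a b c d.
Proof.
have [g <-] := By_pi_onto u; rewrite -[g]free_piK.
elim: (repr g) => [|[l e] w [a [b [c [d IH]]]]].
  exists 0%R, 0%R, 0%R, 0%R; rewrite /normal_form /= !mulg1.
  exact: (morph1 By_piM).
rewrite -cat1s free_piM [By_pi _]By_piM IH.
have [mx mVx] := (normal_form_mulx By_relation By_class a b c d,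
  normal_form_mulVx By_relation By_class a b c d).
have [my mVy] := (normal_form_muly By_relation By_class a b c d,
  normal_form_mulVy By_relation By_class a b c d).
have piV h : By_pi (free_inv h) = (By_pi h)^-1 by exact: (morphV By_piM).
case: e; last by case: l; [rewrite my|rewrite mx]; do 4!eexists.
have -> : free_pi [:: (l, true)] = free_inv (free_gen l) by rewrite -free_piV.
by rewrite piV; case: l; [rewrite mVy|rewrite mVx]; do 4!eexists.
Qed.

(** * The embedding of G in the model *)

Definition F2_model : F2 -> model := free_lift (fun l : bool => if l then my else mx).

Lemma F2_modelM : {morph F2_model : g h / g * h}.
Proof. exact: free_liftM. Qed.

Lemma F2_model_Gamma4 g : normal_set Gamma4 g -> F2_model g = 1.
Proof. by move=> /(morph_Gamma F2_modelM) /Gamma4_model. Qed.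

Definition class3_model : quotient_group Gamma4 -> model := quotient_lift F2_model.

Lemma class3_modelM : {morph class3_model : g h / g * h}.
Proof. exact: quotient_liftM F2_modelM F2_model_Gamma4. Qed.

(** The kernel is normal and contains the relator, because [mB] and [my] commute. *)
Lemma class3_model_By g : normal_set By_closure g -> class3_model g = 1.
Proof.
have kerM := class3_modelM.
suff: normal_set By_closure `<=` [set g | class3_model g = 1] by exact.
apply: smallest_sub => [|_ ->] /=.
  split=> //=; last by move=> h a _ ha; rewrite !kerM ha mulg1 (morphV kerM) mulgV.
  split=> [|a b ha hb|a ha] /=; first exact: morph1 kerM.
    by rewrite kerM ha hb mulg1.
  by rewrite (morphV kerM) ha invg1.
rewrite /class3_model (quotient_lift_pi F2_modelM F2_model_Gamma4).
rewrite !(morph_comm F2_modelM).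
by rewrite /F2_model !free_lift_gen comm_mx_my comm_mB_my.
Qed.

Definition By_model : G_By -> model := quotient_lift class3_model.

Lemma By_modelM : {morph By_model : g h / g * h}.
Proof. exact: quotient_liftM class3_modelM class3_model_By. Qed.

Lemma By_model_pi g : By_model (By_pi g) = F2_model g.
Proof.
rewrite /By_model (quotient_lift_pi class3_modelM class3_model_By).
exact: quotient_lift_pi F2_modelM F2_model_Gamma4 g.
Qed.

Lemma By_model_x : By_model Gx = mx.
Proof. by rewrite By_model_pi /F2_model free_lift_gen. Qed.

Lemma By_model_y : By_model Gy = my.
Proof. by rewrite By_model_pi /F2_model free_lift_gen. Qed.

Lemma By_model_normal_form a b c d :
  By_model (normal_form Gx Gy a b c d) = (a, b, c, d).
Proof.
rewrite /normal_form !By_modelM !(morph_expgz By_modelM) !(morph_comm By_modelM).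
by rewrite By_model_x By_model_y comm_mx_my comm_mB_mx model_normal_form.
Qed.

(** The image of a normal form is its tuple of exponents, so nothing collapses. *)
Lemma By_model_inj : injective By_model.
Proof.
move=> u w; have [a [b [c [d ->]]]] := By_normal_form u.
have [a' [b' [c' [d' ->]]]] := By_normal_form w.
by rewrite !By_model_normal_form => -[-> -> -> ->].
Qed.

(** * The product with Z^n *)

Section ProductWithZn.
Variable n : nat.
Let H : groupType := (G_By * Zpow n)%type.

(** The order starts at the center, so that each coordinate is additive where the later ones vanish;
    in [prod_coord] these four follow the n coordinates of Z^n. *)
Definition By_coord k : model -> int :=
  match k with 0 => cC | 1 => cB | 2 => cy | _ => cx end.

Definition prod_coord (i : nat) (h : H) : int :=
  match insub i : option 'I_n with
  | Some j => (h.2 : 'rV[int]_n) ord0 j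
  | None => By_coord (i - n) (By_model h.1)
  end.

Let m := (n + 4)%N.

Lemma prod_coord_ord (j : 'I_n) h : prod_coord j h = (h.2 : 'rV[int]_n) ord0 j.
Proof. by rewrite /prod_coord valK. Qed.

Lemma prod_coord_By k h : prod_coord (n + k) h = By_coord k (By_model h.1).
Proof. by rewrite /prod_coord insubF ?addKn //; lia. Qed.

Lemma prod_coord_split (Q : nat -> Prop) :
  (forall j : 'I_n, Q j) -> (forall k, (k < 4)%N -> Q (n + k)%N) ->
  forall i, (i < m)%N -> Q i.
Proof.
move=> Qj Qk i im; have [lt_in|le_ni] := ltnP i n; first exact: (Qj (Ordinal lt_in)).
by rewrite -(subnKC le_ni); apply: Qk; rewrite /m in im; lia.
Qed.

Lemma prod_coordM i (g h : H) : (i < m)%N ->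
  coord_stage m prod_coord i.+1 g -> coord_stage m prod_coord i.+1 h ->
  prod_coord i (g * h) = (prod_coord i g + prod_coord i h)%R.
Proof.
move: i; apply: prod_coord_split => [j _ _|k k4 Sg Sh].
  by rewrite !prod_coord_ord mxE.
rewrite !prod_coord_By By_modelM.
have Sk l : (k < l < 4)%N -> By_coord l (By_model g.1) = 0%R.
  by move=> kl; rewrite -prod_coord_By; apply: Sg; rewrite /m; lia.
case: k k4 {Sg Sh} Sk => [|[|[|[|//]]]] _ Sk /=; rewrite ?cxM ?cyM //.
  (* The correction terms carry a factor [cx] or [tri] of it, which vanishes at this stage. *)
  by rewrite cCM [cx _](Sk 3%N isT) tri0 !mul0r !subr0.
by rewrite cBM [cx _](Sk 3%N isT) mul0r addr0.
Qed.

Lemma prod_coord_onto i : (i < m)%N ->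
  exists2 g : H, coord_stage m prod_coord i.+1 g & prod_coord i g = 1%R.
Proof.
move: i; apply: prod_coord_split => [j|k k4].
  exists (1, delta_mx ord0 j : 'rV[int]_n); last by rewrite prod_coord_ord mxE !eqxx.
  move=> i /andP[ji im]; move: i im ji.
  apply: prod_coord_split => [l jl|k k4 _].
    by rewrite prod_coord_ord mxE /= (_ : l == j = false) //; apply/eqP => lj;
      rewrite lj ltnn in jl.
  rewrite prod_coord_By (morph1 By_modelM).
  by case: k k4 => [|[|[|[|//]]]].
(* A unit exponent vector; its entries are reversed below, as [normal_form] lists the exponent of
   [x] first and [By_coord] lists it last. *)
pose e l : int := (if l == k then 1 else 0)%R.
exists (normal_form Gx Gy (e 3%N) (e 2%N) (e 1%N) (e 0%N), 0%R : 'rV[int]_n).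
  move=> i /andP[ki im]; move: i im ki.
  apply: prod_coord_split => [l|l l4 kl]; first by have := ltn_ord l; lia.
  rewrite prod_coord_By By_model_normal_form.
  have : e l = 0%R by rewrite /e ifF //; apply/eqP; lia.
  by case: l l4 {kl} => [|[|[|[|//]]]].
rewrite prod_coord_By By_model_normal_form.
have : e k = 1%R by rewrite /e eqxx.
by case: (k) k4 => [|[|[|[|//]]]].
Qed.

Lemma prod_coord_eq1 (g : H) : coord_stage m prod_coord 0 g -> g = 1.
Proof.
move=> Sg; have c0 i : (i < m)%N -> prod_coord i g = 0%R by move=> im; exact: Sg.
have Bc0 k : (k < 4)%N -> By_coord k (By_model g.1) = 0%R.
  by move=> k4; rewrite -prod_coord_By c0 //; rewrite /m; lia.
have g1 : g.1 = 1.
  apply: By_model_inj; rewrite (morph1 By_modelM).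
  by apply: model_ext;
    [exact: (Bc0 3%N)|exact: (Bc0 2%N)|exact: (Bc0 1%N)|exact: (Bc0 0%N)].
have g2 : g.2 = 1.
  apply/rowP => j; rewrite mxE -prod_coord_ord c0 //.
  by have := ltn_ord j; rewrite /m; lia.
by rewrite [g]surjective_pairing g1 g2.
Qed.

(** The fourth term dies in both factors: in the first through the embedding in the model, in the
    second by commutativity. *)
Lemma prod_nilpotent : nilpotent H.
Proof.
exists 3%N; apply/seteqP; split=> [[u v] Guv|_ ->]; last first.
  by have [[]] := Gamma_normal H 4.
have fstM : {morph (fun h : H => By_model h.1) : g h / g * h}.
  by move=> g h; rewrite -By_modelM.
have sndM : {morph (fun h : H => h.2) : g h / g * h} by [].
have /= u1 := Gamma4_model (morph_Gamma fstM Guv).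
have abZ (g h : Zpow n) : commute g h by exact: addrC.
have /= -> := Gamma_abelian abZ (morph_Gamma sndM Guv).
by rewrite [u](By_model_inj (etrans u1 (esym (morph1 By_modelM)))).
Qed.

Lemma prod_R_infinity : R_infinity H.
Proof.
move=> phi phi_bij.
apply: (@aut_infinite_reidemeister H (fun h => By_model h.1) (Gx, 1) (Gy, 1)).
- by move=> g h; rewrite -By_modelM.
- exact: By_model_x.
- exact: By_model_y.
(* Injectivity of [By_model] reflects commutation in the first factor; the second is abelian. *)
- move=> [g v] [h w] /=; rewrite /commute -!By_modelM => /By_model_inj gh.
  by congr pair; [exact: gh|exact: addrC].
- exact: gmulfM.
- exact: phi_bij.
Qed.

Lemma prod_properties :
  [/\ finitely_generated H, torsion_free H, nilpotent H,
      has_hirsch_length H (n + 4) & R_infinity H].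
Proof.
split.
- exact: coord_finitely_generated prod_coordM prod_coord_onto prod_coord_eq1.
- exact: coord_torsion_free prod_coordM prod_coord_eq1.
- exact: prod_nilpotent.
- exact: coord_hirsch prod_coordM prod_coord_onto prod_coord_eq1.
- exact: prod_R_infinity.
Qed.

End ProductWithZn.

Theorem mainTheorem5 :
  (forall n : nat,
     let H : groupType := (G_By * Zpow n)%type in
     [/\ finitely_generated H, torsion_free H, nilpotent H,
         has_hirsch_length H (n + 4) & R_infinity H]) /\
  (forall l : nat, (4 <= l)%N ->
     exists H : groupType,
     [/\ finitely_generated H, torsion_free H, nilpotent H,
         has_hirsch_length H l & R_infinity H]).
Proof.
split=> [n|l l4]; first exact: prod_properties.
exists (G_By * Zpow (l - 4))%type.
by have := prod_properties (l - 4); rewrite subnK.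
Qed.
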